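(* The set $T=\{B_i(r,\bm n,\bm m):1\le i\le4,\ \bm n,\bm m\in\mathbb N^2,\ r\in\mathbb Z\}\cup\{0\}$ (where $B_i(r,\bm n,\bm m)$ is taken only for the admissible parameters) is an inverse semigroup with respect to operator multiplication and the adjoint operation inherited from $\mathcal L(\ell^2(\mathbb N)\otimes\ell^2(\mathbb N)\otimes\ell^2(\mathbb Z))$.
   Context: $\mathbb N=\{0,1,2,\dots\}$. $S$ is the left shift on $\ell^2(\mathbb N)$ ($Se_0=0$, $Se_n=e_{n-1}$), $p$ is the rank-one projection onto $\mathbb Ce_0$, and $\bm t$ is the left shift on $\ell^2(\mathbb Z)$ ($\bm te_n=e_{n-1}$). For $\bm n=(n_1,n_2),\bm m=(m_1,m_2)\in\mathbb N^2$, $r\in\mathbb Z$, the operators $B_i(r,\bm n,\bm m)$ and their admissible parameters are: $B_1(r,\bm n,\bm m)=S^{*n_1}S^{m_1}\otimes S^{*n_1}S^{m_1}\otimes\bm t^r$ for $r=m_1-n_1$ (convention: $n_1=n_2$, $m_1=m_2$); $B_2(r,\bm n,\bm m)=S^{*n_1}S^{m_1}\otimes S^{*n_2}pS^{m_2}\otimes\bm t^r$ for $r=m_1-n_1$, $n_1\ge n_2$, $m_1\ge m_2$; $B_3(r,\bm n,\bm m)=S^{*n_1}pS^{m_1}\otimes S^{*n_2}S^{m_2}\otimes\bm t^r$ for $r=m_2-n_2$, $n_1\le n_2$, $m_1\le m_2$; $B_4(r,\bm n,\bm m)=S^{*n_1}pS^{m_1}\otimes S^{*n_2}pS^{m_2}\otimes\bm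 t^r$ for any $r\in\mathbb Z$. An inverse semigroup is a semigroup in which every $a$ has a unique $a^*$ with $aa^*a=a$ and $a^*aa^*=a^*$. *)

(* Defs.v *)
From HB Require Import structures.
From mathcomp Require Import all_boot all_order all_algebra finmap.
From mathcomp Require Import complex.
From mathcomp Require Import all_classical all_reals all_analysis.
From mathcomp Require Import ring lra.
From mathcomp.analysis.showcase Require summability.
Import Order.TTheory GRing.Theory Num.Theory numFieldNormedType.Exports.
Import ComplexField.Normc.
Set Implicit Arguments.
Unset Strict Implicit.
Unset Printing Implicit Defensive.
Local Open Scope classical_set_scope.
Local Open Scope ring_scope.
Local Open Scope complex_scope.

#[export] Existing Instance summability.totally_filter.

(* The topology of the complex field R[i] is the one of its norm. *)
HB.instance Definition _ (R : realType) := NormedModule.copy R[i] (R[i])^o.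

Section sequences.
Context (R : realType) (I : choiceType).
Implicit Types (x y : I -> R[i]) (a b : I -> R).

(* esum is the supremum of the finite partial sums, so this is the square of
   the l^2 norm, possibly +oo. *)
Definition l2sq x : \bar R := \esum_(i in [set: I]) (normc (x i) ^+ 2)%:E.

Lemma esum_leP a (B : R) : (forall i, 0 <= a i) ->
  (\esum_(i in [set: I]) (a i)%:E <= B%:E)%E <->
  (forall A : {fset I}, \sum_(i <- A) a i <= B).
Proof.
move=> a0; split=> [h A|h].
  rewrite -lee_fin; apply: le_trans h; apply: esum_ge.
  exists [set` A]; first by split => //; exact: finite_fset.
  by rewrite fsbig_finite//= set_fsetK sumEFin.
apply: ge_ereal_sup => _ [A [finA _] <-].
by rewrite fsbig_finite//= sumEFin lee_fin.
Qed.

Lemma le_esum_fset a (A : {fset I}) : (forall i, 0 <= a i) ->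
  ((\sum_(i <- A) a i)%:E <= \esum_(i in [set: I]) (a i)%:E)%E.
Proof.
move=> a0; apply: esum_ge.
exists [set` A]; first by split => //; exact: finite_fset.
by rewrite fsbig_finite//= set_fsetK sumEFin.
Qed.

Lemma normc_ge0 (z : R[i]) : 0 <= normc z.
Proof. by case: z => u v /=; exact: sqrtr_ge0. Qed.

Lemma normc_sqr_def (z : R[i]) : normc z ^+ 2 = complex.Re z ^+ 2 + complex.Im z ^+ 2.
Proof. by case: z => u v /=; rewrite sqr_sqrtr// addr_ge0// sqr_ge0. Qed.

Lemma normc_sqrD (u v : R[i]) :
  normc (u + v) ^+ 2 <= 2 * normc u ^+ 2 + 2 * normc v ^+ 2.
Proof.
rewrite !normc_sqr_def; case: u v => [a b] [c d].
rewrite -[(a +i* b) + (c +i* d)]/((a + c) +i* (b + d)) /=.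
have := sqr_ge0 (a - c); have := sqr_ge0 (b - d); nra.
Qed.

Lemma l2sq_ge0 x : (0 <= l2sq x)%E.
Proof. by apply: esum_ge0 => i _; rewrite lee_fin sqr_ge0. Qed.

Lemma l2sq_leP x (B : R) : (l2sq x <= B%:E)%E <->
  (forall A : {fset I}, \sum_(i <- A) normc (x i) ^+ 2 <= B).
Proof. by apply: esum_leP => i; rewrite sqr_ge0. Qed.

Definition l2pred : {pred I -> R[i]} := [pred x | (l2sq x < +oo)%E].

Lemma l2predP x : reflect
  (exists B : R, forall A : {fset I}, \sum_(i <- A) normc (x i) ^+ 2 <= B)
  (x \in l2pred).
Proof.
apply: (iffP idP) => [|[B /l2sq_leP]]; rewrite inE => h.
  exists (fine (l2sq x)); apply/l2sq_leP.
  by rewrite fineK// ge0_fin_numE// l2sq_ge0.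
exact: le_lt_trans h (ltry _).
Qed.

Lemma l2pred_submod : subsemimod_closed l2pred.
Proof.
split; first split.
- apply/l2predP; exists 0 => A; rewrite big1// => i _.
  by rewrite normc0 expr0n.
- move=> x y /l2predP[B hB] /l2predP[D hD]; apply/l2predP.
  exists (2 * B + 2 * D) => A.
  apply: (@le_trans _ _ (\sum_(i <- A) (2 * normc (x i) ^+ 2 + 2 * normc (y i) ^+ 2))).
    by apply: ler_sum => i _; exact: normc_sqrD.
  by rewrite big_split/= -!mulr_sumr lerD// ler_wpM2l.
- move=> c x /l2predP[B hB]; apply/l2predP; exists (normc c ^+ 2 * B) => A.
  rewrite (eq_bigr (fun i => normc c ^+ 2 * normc (x i) ^+ 2)); last first.
    by move=> i _; rewrite normcM exprMn.
  by rewrite -mulr_sumr ler_wpM2l// sqr_ge0.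
Qed.
HB.instance Definition _ :=
  GRing.isSubmodClosed.Build R[i] (I -> R[i]) l2pred l2pred_submod.

(* The space l^2(I) of complex square-summable families. *)
Record l2 := L2 { l2fun :> I -> R[i] ; _ : l2fun \in l2pred }.
HB.instance Definition _ := [isSub for l2fun].
HB.instance Definition _ := [Choice of l2 by <:].
HB.instance Definition _ := [SubChoice_isSubLmodule of l2 by <:].

End sequences.

Section summation.
Context (R : realType) (I : choiceType).
Implicit Types (f g : I -> R[i]) (a : I -> R).
Local Notation totally := (@summability.totally I).

Definition abs_summable f :=
  exists B : R, forall A : {fset I}, \sum_(i <- A) normc (f i) <= B.

Lemma partial_sumE (V : zmodType) (f : I -> V) (A : {fset I}) :
  summability.partial_sum f A = \sum_(i <- A) f i.
Proof. by rewrite /summability.partial_sum big_seq_fsetE. Qed.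

Lemma normc_realB (r s : R) : normc (r%:C - s%:C) = `|r - s|.
Proof.
rewrite -[r%:C - s%:C]/((r - s) +i* (0 - 0)) /=.
by rewrite subr0 expr0n addr0 sqrtr_sqr.
Qed.

Lemma ccvgP (u : {fset I} -> R[i]) (l : R[i]) :
  (forall e : R, 0 < e -> \forall A \near totally, normc (l - u A) <= e) ->
  u @ totally --> l.
Proof.
move=> h; apply/cvgrPdist_le => e e0.
have ee : e = (complex.Re e)%:C by rewrite RRe_real// gtr0_real.
have e0' : 0 < complex.Re e by rewrite -ltcR -ee.
by apply: filterS (h _ e0') => A; rewrite normc_def ee lecR; case: (_ - _).
Qed.

Lemma ccvg_ext (u v : {fset I} -> R[i]) (l : R[i]) :
  u =1 v -> u @ totally --> l -> v @ totally --> l.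
Proof. by move=> /funext ->. Qed.

Lemma ccvgD (u v : {fset I} -> R[i]) (l m : R[i]) :
  u @ totally --> l -> v @ totally --> m ->
  (fun A => u A + v A) @ totally --> l + m.
Proof. exact: cvgD. Qed.

Lemma ccvgB (u v : {fset I} -> R[i]) (l m : R[i]) :
  u @ totally --> l -> v @ totally --> m ->
  (fun A => u A - v A) @ totally --> l - m.
Proof. exact: cvgB. Qed.

Lemma ccvg_dist (u : {fset I} -> R[i]) (l : R[i]) : u @ totally --> l ->
  forall e : R, 0 < e -> \forall A \near totally, normc (l - u A) <= e.
Proof.
move=> /cvgrPdist_le h e e0.
have e0' : 0 < e%:C by rewrite ltcR.
by apply: filterS (h _ e0') => A; rewrite normc_def lecR; case: (_ - _).
Qed.

Lemma ccvgZ (c : R[i]) (u : {fset I} -> R[i]) (l : R[i]) :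
  u @ totally --> l -> (fun A => c * u A) @ totally --> c * l.
Proof.
move=> ul; apply: ccvgP => e e0.
have c0 : 0 < normc c + 1 by rewrite ltr_wpDl// normc_ge0.
have := ccvg_dist ul (divr_gt0 e0 c0); apply: filterS => A h.
rewrite -mulrBr normcM; apply: (@le_trans _ _ ((normc c + 1) * (e / (normc c + 1)))).
  by apply: ler_pM => //; rewrite ?normc_ge0// lerDl.
by rewrite mulrC divfK// gt_eqF.
Qed.

Lemma subset_sum_le a (A B : {fset I}) : (forall i, 0 <= a i) ->
  (A `<=` B)%fset -> \sum_(i <- A) a i <= \sum_(i <- B) a i.
Proof.
move=> a0 AB; rewrite (big_fsetID _ (mem A) B)/=.
have -> : [fset x | x in B & x \in A]%fset = A.
  apply/fsetP => x; rewrite !inE /= andbC.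
  by case: (boolP (x \in A)) => //= /(fsubsetP AB).
by rewrite lerDl sumr_ge0.
Qed.

Lemma real_sum_adherent a (B : R) : (forall i, 0 <= a i) ->
  (forall A : {fset I}, \sum_(i <- A) a i <= B) ->
  exists s : R, (forall A : {fset I}, \sum_(i <- A) a i <= s) /\
   forall e : R, 0 < e -> exists A : {fset I}, forall C : {fset I},
     (A `<=` C)%fset -> s - e <= \sum_(i <- C) a i.
Proof.
move=> a0 aB; pose E := [set \sum_(i <- A) a i | A in [set: {fset I}]].
have Es : has_sup E.
  split; first by exists (\sum_(i <- fset0) a i); exists fset0.
  by exists B => _ [A _ <-].
exists (sup E); split=> [A|e e0].
  by apply: ub_le_sup; [exact: Es.2 | exists A].
have [_ [A _ <-] h] := sup_adherent e0 Es.
by exists A => C AC; apply: le_trans (ltW h) _; exact: subset_sum_le.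
Qed.

Lemma nneg_cvg a : (forall i, 0 <= a i) ->
  (exists B : R, forall A : {fset I}, \sum_(i <- A) a i <= B) ->
  exists l : R, (fun A : {fset I} => (\sum_(i <- A) a i)%:C) @ totally --> l%:C.
Proof.
move=> a0 [B /(real_sum_adherent a0)[s [sub sa]]]; exists s; apply: ccvgP => e e0.
have [A hA] := sa e e0; exists A => // C AC.
rewrite normc_realB ger0_norm ?subr_ge0//.
by rewrite lerBlDr -lerBlDl; exact: hA.
Qed.

Lemma real_cvg a : abs_summable (fun i => (a i)%:C) ->
  exists l : R[i], (fun A : {fset I} => (\sum_(i <- A) a i)%:C) @ totally --> l.
Proof.
move=> [B aB].
have nE r : normc r%:C = `|r| :> R by rewrite /= expr0n addr0 sqrtr_sqr.
have [|l hl] := @nneg_cvg (fun i => `|a i|) (fun=> normr_ge0 _).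
  by exists B => A; rewrite (eq_bigr (fun i => normc (a i)%:C)).
have [i||m hm] := @nneg_cvg (fun i => `|a i| + a i).
  - by rewrite -lerBlDr sub0r -normrN ler_norm.
  - exists (B + B) => A; apply: (@le_trans _ _ (\sum_(i <- A) (`|a i| + `|a i|))).
      by apply: ler_sum => i _; rewrite lerD2l ler_norm.
    have h : \sum_(i <- A) `|a i| <= B.
      by apply: le_trans (aB A); apply: ler_sum => i _; rewrite nE.
    by rewrite big_split/= lerD.
exists (m%:C - l%:C).
apply: ccvg_ext (ccvgB hm hl) => A.
by rewrite big_split/= rmorphD/= addrC addKr.
Qed.

Lemma normc_Re (z : R[i]) : `|complex.Re z| <= normc z.
Proof.
rewrite -sqrtr_sqr; case: z => u v /=; rewrite ler_sqrt ?lerDl ?sqr_ge0//.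
by rewrite addr_ge0 ?sqr_ge0.
Qed.

Lemma normc_Im (z : R[i]) : `|complex.Im z| <= normc z.
Proof.
rewrite -sqrtr_sqr; case: z => u v /=; rewrite ler_sqrt ?lerDr ?sqr_ge0//.
by rewrite addr_ge0 ?sqr_ge0.
Qed.

Lemma csum_cvg f : abs_summable f ->
  (fun A : {fset I} => \sum_(i <- A) f i) @ totally --> summability.sum f.
Proof.
move=> [B fB].
have nE r : normc r%:C = `|r| :> R by rewrite /= expr0n addr0 sqrtr_sqr.
have [|l hl] := @real_cvg (fun i => complex.Re (f i)).
  exists B => A; apply: le_trans (fB A); apply: ler_sum => i _.
  by rewrite nE normc_Re.
have [|m hm] := @real_cvg (fun i => complex.Im (f i)).
  exists B => A; apply: le_trans (fB A); apply: ler_sum => i _.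
  by rewrite nE normc_Im.
have h := ccvgD hl (@ccvgZ 'i%C _ _ hm).
have {}h : (fun A : {fset I} => \sum_(i <- A) f i) @ totally --> (l + 'i%C * m).
  apply: ccvg_ext h => A.
  rewrite !rmorph_sum mulr_sumr -big_split/=.
  by apply: eq_bigr => i _; rewrite -complexE.
rewrite /summability.sum.
rewrite (_ : summability.partial_sum f = (fun A => \sum_(i <- A) f i)).
  by apply: cvgP h.
by apply/funext => A; rewrite partial_sumE.
Qed.

Lemma csum_unique f l : abs_summable f ->
  (fun A : {fset I} => \sum_(i <- A) f i) @ totally --> l ->
  summability.sum f = l.
Proof.
move=> /csum_cvg h1 h2.
exact: (cvg_unique (@norm_hausdorff _ R[i]) h1 h2).
Qed.

Lemma abs_summableD f g : abs_summable f -> abs_summable g ->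
  abs_summable (fun i => f i + g i).
Proof.
move=> [B hB] [D hD]; exists (B + D) => A.
apply: le_trans (lerD (hB A) (hD A)); rewrite -big_split/=.
by apply: ler_sum => i _; exact: le_normcD.
Qed.

Lemma abs_summableZ c f : abs_summable f -> abs_summable (fun i => c * f i).
Proof.
move=> [B hB]; exists (normc c * B) => A.
under eq_bigr do rewrite normcM.
by rewrite -mulr_sumr ler_wpM2l// normc_ge0.
Qed.

Lemma csumD f g : abs_summable f -> abs_summable g ->
  summability.sum (fun i => f i + g i) = summability.sum f + summability.sum g.
Proof.
move=> hf hg; apply: csum_unique; first exact: abs_summableD.
apply: ccvg_ext (ccvgD (csum_cvg hf) (csum_cvg hg)) => A.
by rewrite big_split.
Qed.

Lemma csumZ c f : abs_summable f ->
  summability.sum (fun i => c * f i) = c * summability.sum f.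
Proof.
move=> hf; apply: csum_unique; first exact: abs_summableZ.
by apply: ccvg_ext (@ccvgZ c _ _ (csum_cvg hf)) => A; rewrite mulr_sumr.
Qed.

Lemma normc_sum_le (f : I -> R[i]) (r : seq I) :
  normc (\sum_(i <- r) f i) <= \sum_(i <- r) normc (f i).
Proof.
elim/big_ind2 : _ => //; first by rewrite normc0.
by move=> u a v b ua vb; apply: le_trans (le_normcD _ _) _; exact: lerD.
Qed.

Lemma csum_le f (B : R) : (forall A : {fset I}, \sum_(i <- A) normc (f i) <= B) ->
  normc (summability.sum f) <= B.
Proof.
move=> fB; have fs : abs_summable f by exists B.
apply/ler_addgt0Pr => e e0.
have [A /=] := filter_ex (ccvg_dist (csum_cvg fs) e0).
set s := summability.sum f; set t := \sum_(i <- A) f i => h.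
rewrite -(subrK t s) addrC; apply: le_trans (le_normcD _ _) _.
by apply: lerD => //; apply: le_trans (normc_sum_le _ _) _.
Qed.

End summation.

Section l2_theory.
Context (R : realType) (I : choiceType).
Local Notation l2 := (l2 R I).
Local Notation totally := (@summability.totally I).
Implicit Types (x y z : l2) (A B F : {fset I}).

Definition nsq x : R := fine (l2sq x).

Definition l2norm x : R := Num.sqrt (nsq x).

(* summability.sum is the limit of the partial sums along the finite subsets
   of I; the inner product is linear in its first argument. *)
Definition inner x y : R[i] := summability.sum (fun i => x i * (y i)^*).

Lemma l2_ext x y : x =1 y -> x = y.
Proof. by move=> /funext h; apply/val_inj. Qed.

Lemma l2E0 i : (0 : l2) i = 0. Proof. by []. Qed.
Lemma l2ED x y i : (x + y) i = x i + y i. Proof. by []. Qed.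
Lemma l2EN x i : (- x) i = - x i. Proof. by []. Qed.
Lemma l2EZ (c : R[i]) x i : (c *: x) i = c * x i. Proof. by []. Qed.
Lemma l2E_sum (J : Type) (r : seq J) (f : J -> l2) i :
  (\sum_(j <- r) f j) i = \sum_(j <- r) f j i.
Proof. by elim/big_ind2 : _ => // x a y b <- <-. Qed.

Lemma nsqE x : l2sq x = (nsq x)%:E.
Proof.
rewrite /nsq fineK// ge0_fin_numE ?l2sq_ge0//.
by case: x => x /=; rewrite inE.
Qed.

Lemma nsq_ge0 x : 0 <= nsq x.
Proof. by rewrite -lee_fin -nsqE l2sq_ge0. Qed.

Lemma nsq_leP x (b : R) :
  nsq x <= b <-> forall A, \sum_(i <- A) normc (x i) ^+ 2 <= b.
Proof. by rewrite -lee_fin -nsqE; exact: l2sq_leP. Qed.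

Lemma nsq_ge x A : \sum_(i <- A) normc (x i) ^+ 2 <= nsq x.
Proof. by move: A; apply/nsq_leP. Qed.

Lemma nsq_ge1 x i : normc (x i) ^+ 2 <= nsq x.
Proof. by have := nsq_ge x [fset i]%fset; rewrite big_seq_fset1. Qed.

Lemma nsqZ (c : R[i]) x : nsq (c *: x) <= normc c ^+ 2 * nsq x.
Proof.
apply/nsq_leP => A; under eq_bigr do rewrite l2EZ normcM exprMn.
by rewrite -mulr_sumr ler_wpM2l ?sqr_ge0 ?nsq_ge.
Qed.

Lemma nsqD x y : nsq (x + y) <= 2 * nsq x + 2 * nsq y.
Proof.
apply/nsq_leP => A.
apply: (@le_trans _ _ (\sum_(i <- A) (2 * normc (x i) ^+ 2 + 2 * normc (y i) ^+ 2))).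
  by apply: ler_sum => i _; exact: normc_sqrD.
by rewrite big_split/= -!mulr_sumr lerD// ler_wpM2l// nsq_ge.
Qed.

Lemma nsq0 : nsq 0 = 0.
Proof.
apply/eqP; rewrite eq_le nsq_ge0 andbT; apply/nsq_leP => A.
by rewrite big1// => i _; rewrite l2E0 normc0 expr0n.
Qed.

Lemma nsqN x : nsq (- x) = nsq x.
Proof.
have h z : nsq (- z) <= nsq z.
  by apply/nsq_leP => A; under eq_bigr do rewrite l2EN normcN; exact: nsq_ge.
by apply/eqP; rewrite eq_le h -{1}(opprK x) h.
Qed.

Lemma nsq_eq0 x : nsq x <= 0 -> x = 0.
Proof.
move=> x0; apply: l2_ext => i; apply: eq0_normc; apply/eqP.
by rewrite -sqrf_eq0 eq_le sqr_ge0 andbT (le_trans (nsq_ge1 x i)).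
Qed.

Lemma inner_term_le x y A :
  \sum_(i <- A) normc (x i * (y i)^* ) <= (nsq x + nsq y) / 2.
Proof.
rewrite ler_pdivlMr// mulr_suml.
apply: (@le_trans _ _ (\sum_(i <- A) (normc (x i) ^+ 2 + normc (y i) ^+ 2))).
  apply: ler_sum => i _; rewrite normcM.
  have -> : normc (y i)^* = normc (y i) by case: (y i) => a b /=; rewrite sqrrN.
  have := sqr_ge0 (normc (x i) - normc (y i)); nra.
by rewrite big_split lerD ?nsq_ge.
Qed.

Lemma inner_summable x y : abs_summable (fun i => x i * (y i)^* ).
Proof. by exists ((nsq x + nsq y) / 2) => A; exact: inner_term_le. Qed.

Lemma innerDl x y z : inner (x + y) z = inner x z + inner y z.
Proof.
rewrite /inner -csumD; [|exact: inner_summable..].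
by congr (summability.sum _); apply/funext => i; rewrite l2ED mulrDl.
Qed.

Lemma innerZl (c : R[i]) x z : inner (c *: x) z = c * inner x z.
Proof.
rewrite /inner -csumZ; last exact: inner_summable.
by congr (summability.sum _); apply/funext => i; rewrite l2EZ mulrA.
Qed.

Lemma innerDr x y z : inner x (y + z) = inner x y + inner x z.
Proof.
rewrite /inner -csumD; [|exact: inner_summable..].
by congr (summability.sum _); apply/funext => i; rewrite l2ED rmorphD/= mulrDr.
Qed.

Lemma innerZr (c : R[i]) x y : inner x (c *: y) = c^* * inner x y.
Proof.
rewrite /inner -csumZ; last exact: inner_summable.
by congr (summability.sum _); apply/funext => i; rewrite l2EZ rmorphM/= mulrCA.
Qed.

Lemma inner0l z : inner 0 z = 0.
Proof. by rewrite -(scale0r (0 : l2)) innerZl mul0r. Qed.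

Lemma innerNl x z : inner (- x) z = - inner x z.
Proof. by rewrite -scaleN1r innerZl mulN1r. Qed.

Lemma inner_suml (J : Type) (r : seq J) (f : J -> l2) z :
  inner (\sum_(j <- r) f j) z = \sum_(j <- r) inner (f j) z.
Proof.
elim: r => [|j r ih]; first by rewrite !big_nil inner0l.
by rewrite !big_cons innerDl ih.
Qed.

Lemma normc_inner_le x y : normc (inner x y) <= (nsq x + nsq y) / 2.
Proof. by apply: csum_le => A; exact: inner_term_le. Qed.

Lemma cauchy_schwarz x y : normc (inner x y) ^+ 2 <= nsq x * nsq y.
Proof.
set c := normc (inner x y).
have c0 : 0 <= c by exact: normc_ge0.
have a0 := nsq_ge0 x; have b0 := nsq_ge0 y.
have h (t : R) : 0 < t -> 2 * t * c <= t ^+ 2 * nsq x + nsq y.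
  move=> t0; have := normc_inner_le (t%:C *: x) y.
  rewrite innerZl normcM.
  have -> : normc t%:C = t by rewrite /= expr0n addr0 sqrtr_sqr gtr0_norm.
  have := nsqZ t%:C x.
  have -> : normc t%:C ^+ 2 = t ^+ 2 by rewrite /= expr0n addr0 sqrtr_sqr gtr0_norm.
  by rewrite -/c; nra.
have [cE|cN0] := eqVneq c 0; first by rewrite cE expr0n mulr_ge0.
have {cN0}c0 : 0 < c by rewrite lt_neqAle eq_sym cN0.
have [aE|aN0] := eqVneq (nsq x) 0.
  have := h ((nsq y + 1) / c); rewrite aE mulr0 add0r divr_gt0 ?ltr_wpDl//.
  by move=> /(_ isT); rewrite -mulrA divfK ?gt_eqF// => ?; exfalso; lra.
have {aN0}a0 : 0 < nsq x by rewrite lt_neqAle eq_sym aN0.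
have := h (c / nsq x); rewrite divr_gt0// => /(_ isT).
set t := c / nsq x; have tE : t * nsq x = c by rewrite divfK// gt_eqF.
by rewrite -tE; nra.
Qed.

Lemma basis_subproof i : (fun j => (j == i)%:R : R[i]) \in @l2pred R I.
Proof.
apply/l2predP; exists 1 => A.
rewrite (eq_bigr (fun j => (j == i)%:R)); last first.
  by move=> j _; case: eqP => _; rewrite ?normc1 ?normc0 ?expr1n// expr0n.
rewrite -natr_sum -big_mkcond/= sum1_count count_uniq_mem ?fset_uniq//.
by rewrite lern1 leq_b1.
Qed.

Definition l2basis i : l2 := L2 (basis_subproof i).

Lemma l2basisE i j : l2basis i j = (j == i)%:R. Proof. by []. Qed.

Lemma sum_basisE (c : I -> R[i]) F j :
  (\sum_(i <- F) c i *: l2basis i) j = if j \in F then c j else 0.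
Proof.
rewrite l2E_sum; case: ifPn => jF.
  rewrite (big_fsetD1 j)// l2EZ l2basisE eqxx mulr1 big_seq big1 => [|i].
    by rewrite /= addr0.
  by rewrite !inE l2EZ l2basisE => /andP[/negPf]; rewrite eq_sym => -> _; rewrite mulr0.
rewrite big_seq big1// => i iF; rewrite l2EZ l2basisE.
by case: eqP => [ji|_]; rewrite ?mulr0//; rewrite ji iF in jF.
Qed.

Lemma nsq_sum_basis (c : I -> R[i]) F :
  nsq (\sum_(i <- F) c i *: l2basis i) <= \sum_(i <- F) normc (c i) ^+ 2.
Proof.
apply/nsq_leP => A.
rewrite (eq_bigr (fun i => if i \in F then normc (c i) ^+ 2 else 0)); last first.
  by move=> i _; rewrite sum_basisE; case: ifP => //; rewrite normc0 expr0n.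
rewrite -big_mkcond/= big_fset_condE/=; apply: subset_sum_le => [i|].
  exact: sqr_ge0.
by apply/fsubsetP => i; rewrite !inE => /andP[].
Qed.

Lemma l2_approx x (e : R) : 0 < e -> exists F0, forall F, (F0 `<=` F)%fset ->
  nsq (x - \sum_(i <- F) x i *: l2basis i) <= e.
Proof.
move=> e0.
have [|s [sub sa]] := @real_sum_adherent _ I (fun i => normc (x i) ^+ 2) (nsq x)
  (fun=> sqr_ge0 _); first by move=> A; exact: nsq_ge.
have [F0 hF0] := sa e e0; exists F0 => F F0F; apply/nsq_leP => A.
rewrite (eq_bigr (fun i => if i \notin F then normc (x i) ^+ 2 else 0)); last first.
  move=> i _; rewrite l2ED l2EN sum_basisE; case: ifP => _ /=.
    by rewrite subrr normc0 expr0n.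
  by rewrite subr0.
rewrite -big_mkcond/= big_fset_condE/=.
set A' := [fset i | i in A & _]%fset.
have := sub (F `|` A')%fset; rewrite (big_fsetID _ (mem F))/=.
have -> : [fset i in (F `|` A')%fset | i \in F]%fset = F.
  by apply/fsetP => i; rewrite !inE /=; case: (i \in F); rewrite ?andbF ?andbT.
have -> : [fset i in (F `|` A')%fset | i \notin F]%fset = A'.
  by apply/fsetP => i; rewrite !inE /=; case: (i \in F); rewrite ?andbF ?andbT.
by have := hF0 F F0F; lra.
Qed.

Lemma inner_basisr x i : inner x (l2basis i) = x i.
Proof.
apply: csum_unique; first exact: inner_summable.
apply: ccvgP => e e0; exists [fset i]%fset => // F /fsubsetP iF.
have {}iF : i \in F by apply: iF; rewrite inE.
rewrite (big_fsetD1 i)// l2basisE eqxx rmorph1 mulr1 big_seq big1 => [|j].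
  by rewrite /= addr0 subrr normc0 ltW.
by rewrite !inE l2basisE => /andP[/negPf ->] _; rewrite rmorph0 mulr0.
Qed.

End l2_theory.

Section bounded_operators.
Context (R : realType) (I : choiceType).
Local Notation l2 := (l2 R I).
Implicit Types (x y z : l2).

Definition is_bounded (f : l2 -> l2) :=
  exists M : R, forall x, l2norm (f x) <= M * l2norm x.

(* L(l^2(I)); it is made below into a ring for composition. *)
Record bop := Bop {
  bop_fun :> l2 -> l2 ;
  bop_linear : linear bop_fun ;
  bop_bounded : is_bounded bop_fun }.

Implicit Types (S T U : bop).

HB.instance Definition _ T :=
  GRing.isLinear.Build R[i] l2 l2 *:%R T (bop_linear T).

HB.instance Definition _ := gen_eqMixin bop.
HB.instance Definition _ := gen_choiceMixin bop.

Lemma bop_ext S T : S =1 T -> S = T.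
Proof.
case: S T => [f fl fb] [g gl gb] /= /funext fg.
by subst g; congr Bop; exact: Prop_irrelevance.
Qed.

Lemma l2norm_sqr x : l2norm x ^+ 2 = nsq x.
Proof. by rewrite sqr_sqrtr// nsq_ge0. Qed.

Lemma boundedP (f : l2 -> l2) :
  is_bounded f <-> exists M : R, 0 <= M /\ forall x, nsq (f x) <= M * nsq x.
Proof.
split=> [[M fM]|[M [M0 fM]]].
  exists (M ^+ 2); split=> [|x]; first exact: sqr_ge0.
  rewrite -!l2norm_sqr -exprMn ler_pXn2r// nnegrE ?sqrtr_ge0//.
  by apply: le_trans (fM x); exact: sqrtr_ge0.
exists (Num.sqrt M) => x.
by rewrite /l2norm -sqrtrM// ler_sqrt// mulr_ge0 ?nsq_ge0.
Qed.

Lemma bop_nsq T : exists M : R, 0 <= M /\ forall x, nsq (T x) <= M * nsq x.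
Proof. exact/boundedP/bop_bounded. Qed.

Fact bop0_linear : linear (fun _ : l2 => 0 : l2).
Proof. by move=> c x y; rewrite scaler0 addr0. Qed.
Fact bop0_bounded : is_bounded (fun=> 0).
Proof. by apply/boundedP; exists 0; split=> // x; rewrite mul0r nsq0. Qed.
Definition bop0 := Bop bop0_linear bop0_bounded.

Fact bop_add_linear S T : linear (fun x => S x + T x).
Proof. by move=> c x y; rewrite !linearP scalerDr addrACA. Qed.
Fact bop_add_bounded S T : is_bounded (fun x => S x + T x).
Proof.
have [M [M0 hM]] := bop_nsq S; have [N [N0 hN]] := bop_nsq T.
apply/boundedP; exists (2 * M + 2 * N); split=> [|x].
  by rewrite addr_ge0// mulr_ge0.
by apply: le_trans (nsqD _ _) _; have := hM x; have := hN x; lra.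
Qed.
Definition bop_add S T := Bop (bop_add_linear S T) (bop_add_bounded S T).

Fact bop_opp_linear T : linear (fun x => - T x).
Proof. by move=> c x y; rewrite linearP opprD scalerN. Qed.
Fact bop_opp_bounded T : is_bounded (fun x => - T x).
Proof.
have [M [M0 hM]] := bop_nsq T.
by apply/boundedP; exists M; split=> // x; rewrite nsqN.
Qed.
Definition bop_opp T := Bop (bop_opp_linear T) (bop_opp_bounded T).

Fact bop1_linear : linear (fun x : l2 => x).
Proof. by []. Qed.
Fact bop1_bounded : is_bounded (fun x => x).
Proof. by exists 1 => x; rewrite mul1r. Qed.
Definition bop1 := Bop bop1_linear bop1_bounded.

Fact bop_mul_linear S T : linear (fun x => S (T x)).
Proof. by move=> c x y; rewrite !linearP. Qed.
Fact bop_mul_bounded S T : is_bounded (fun x => S (T x)).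
Proof.
have [M [M0 hM]] := bop_nsq S; have [N [N0 hN]] := bop_nsq T.
apply/boundedP; exists (M * N); split=> [|x]; first exact: mulr_ge0.
by apply: le_trans (hM _) _; rewrite -mulrA ler_wpM2l.
Qed.
Definition bop_mul S T := Bop (bop_mul_linear S T) (bop_mul_bounded S T).

Fact bop_addA : associative bop_add.
Proof. by move=> S T U; apply: bop_ext => x /=; rewrite addrA. Qed.
Fact bop_addC : commutative bop_add.
Proof. by move=> S T; apply: bop_ext => x /=; rewrite addrC. Qed.
Fact bop_add0 : left_id bop0 bop_add.
Proof. by move=> T; apply: bop_ext => x /=; rewrite add0r. Qed.
Fact bop_addN : left_inverse bop0 bop_opp bop_add.
Proof. by move=> T; apply: bop_ext => x /=; rewrite addNr. Qed.
HB.instance Definition _ :=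
  GRing.isZmodule.Build bop bop_addA bop_addC bop_add0 bop_addN.

Fact bop_mulA : associative bop_mul.
Proof. by move=> S T U; apply: bop_ext. Qed.
Fact bop_mul1l : left_id bop1 bop_mul.
Proof. by move=> T; apply: bop_ext. Qed.
Fact bop_mul1r : right_id bop1 bop_mul.
Proof. by move=> T; apply: bop_ext. Qed.
Fact bop_mulDl : left_distributive bop_mul +%R.
Proof. by move=> S T U; apply: bop_ext. Qed.
Fact bop_mulDr : right_distributive bop_mul +%R.
Proof. by move=> S T U; apply: bop_ext => x /=; rewrite linearD. Qed.
HB.instance Definition _ := GRing.Zmodule_isPzRing.Build bop
  bop_mulA bop_mul1l bop_mul1r bop_mulDl bop_mulDr.

Lemma bop0E x : (0 : bop) x = 0. Proof. by []. Qed.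
Lemma bop1E x : (1 : bop) x = x. Proof. by []. Qed.
Lemma bopME S T x : (S * T) x = S (T x). Proof. by []. Qed.

Lemma bop_inner_approx T x y (e : R) : 0 < e ->
  exists F0 : {fset I}, forall F, (F0 `<=` F)%fset ->
  normc (inner (T x) y - \sum_(i <- F) x i * inner (T (l2basis R i)) y) <= e.
Proof.
move=> e0; have [M [M0 hM]] := bop_nsq T.
pose K := M * nsq y + 1.
have K0 : 0 < K by rewrite ltr_wpDl// mulr_ge0// nsq_ge0.
have [F0 hF0] := l2_approx x (divr_gt0 (exprn_gt0 2 e0) K0).
exists F0 => F /hF0 {}hF0.
have -> : \sum_(i <- F) x i * inner (T (l2basis R i)) y =
    inner (T (\sum_(i <- F) x i *: l2basis R i)) y.
  rewrite linear_sum inner_suml; apply: eq_bigr => i _.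
  by rewrite linearZ innerZl.
rewrite -innerNl -innerDl -linearB.
set v := x - _ in hF0 *.
rewrite -(@ler_pXn2r _ 2)// ?nnegrE ?normc_ge0 ?(ltW e0)//.
apply: le_trans (cauchy_schwarz _ _) _.
apply: (@le_trans _ _ (nsq v * (M * nsq y))).
  by rewrite mulrCA mulrA ler_wpM2r ?nsq_ge0 ?hM.
have -> : e ^+ 2 = e ^+ 2 / K * K by rewrite divfK// gt_eqF.
by apply: ler_pM; rewrite ?nsq_ge0 ?mulr_ge0 ?nsq_ge0// lerDl.
Qed.

Lemma bop_eq_basis S T :
  (forall i, S (l2basis R i) = T (l2basis R i)) -> S = T.
Proof.
move=> ST; apply: bop_ext => x; apply: l2_ext => j.
rewrite -(inner_basisr (S x)) -(inner_basisr (T x)).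
apply/eqP; rewrite -subr_eq0; apply/eqP/eq0_normc/eqP.
rewrite eq_le normc_ge0 andbT; apply/ler_addgt0Pr => e e0; rewrite add0r.
have e2 : 0 < e / 2 by rewrite divr_gt0.
have [F hF] := bop_inner_approx S x (l2basis R j) e2.
have [G hG] := bop_inner_approx T x (l2basis R j) e2.
have := hF _ (fsubsetUl F G); have := hG _ (fsubsetUr F G).
under eq_bigr do rewrite -ST.
set s := bigop.body _ _ _ => h1 h2.
rewrite -(subrKA s) (le_trans (le_normcD _ _))//.
have -> : e = e / 2 + e / 2 by rewrite -splitr.
by rewrite lerD// -normcN opprB.
Qed.

Definition is_adjoint T U := forall x y, inner (T x) y = inner x (U y).

Section adjoint_construction.
Context (T : bop).

Let g y (i : I) : R[i] := (inner (T (l2basis R i)) y)^*.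

Let g_le : exists M : R, 0 <= M /\
  forall y (F : {fset I}), \sum_(i <- F) normc (g y i) ^+ 2 <= M * nsq y.
Proof.
have [M [M0 hM]] := bop_nsq T; exists M; split=> // y F.
set s := \sum_(i <- F) _.
have s0 : 0 <= s by apply: sumr_ge0 => i _; exact: sqr_ge0.
pose v := \sum_(i <- F) g y i *: l2basis R i.
have vs : nsq v <= s by exact: nsq_sum_basis.
have E : inner (T v) y = s%:C.
  rewrite linear_sum inner_suml /s rmorph_sum; apply: eq_bigr => i _.
  rewrite linearZ innerZl /g; case: (inner _ _) => a b.
  by apply/eqP; rewrite eq_complex normc_sqr_def /=; apply/andP; split; apply/eqP; ring.
have := cauchy_schwarz (T v) y; rewrite E.
have -> : normc s%:C = s by rewrite /= expr0n addr0 sqrtr_sqr ger0_norm.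
move=> h; have [->|sN0] := eqVneq s 0; first by rewrite mulr_ge0 ?nsq_ge0.
have {}s0 : 0 < s by rewrite lt_neqAle eq_sym sN0.
rewrite -(ler_pM2l s0) -expr2; apply: le_trans h _.
rewrite mulrA ler_wpM2r ?nsq_ge0//; apply: le_trans (hM v) _.
by rewrite mulrC ler_wpM2r.
Qed.

Let g_l2 y : g y \in @l2pred R I.
Proof. by have [M [_ h]] := g_le; apply/l2predP; exists (M * nsq y). Qed.

Let a y : l2 := L2 (g_l2 y).

Let a_linear : linear a.
Proof.
move=> c x y; apply: l2_ext => i; rewrite l2ED l2EZ /= /g innerDr innerZr.
by rewrite rmorphD rmorphM /= conjcK.
Qed.

Let a_bounded : is_bounded a.
Proof.
have [M [M0 h]] := g_le; apply/boundedP; exists M; split=> // y.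
by apply/nsq_leP => F; exact: h.
Qed.

Lemma adjoint_exists : exists U, is_adjoint T U.
Proof.
exists (Bop a_linear a_bounded) => x y; apply/esym.
apply: csum_unique; first exact: inner_summable.
apply: ccvgP => e e0; have [F0 h] := bop_inner_approx T x y e0.
exists F0 => // F /h; congr (normc (_ - _) <= _).
apply: eq_bigr => i _; congr (_ * _).
by rewrite -[RHS]/((g y i)^*) /g conjcK.
Qed.

End adjoint_construction.

Lemma adjoint_unique T U V : is_adjoint T U -> is_adjoint T V -> U = V.
Proof.
move=> TU TV; apply: bop_ext => y; apply: l2_ext => i.
have E W : is_adjoint T W -> inner (l2basis R i) (W y) = (W y i)^*.
  move=> _; apply: csum_unique; first exact: inner_summable.
  apply: ccvgP => e e0; exists [fset i]%fset => // F /fsubsetP iF.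
  have {}iF : i \in F by apply: iF; rewrite inE.
  rewrite (big_fsetD1 i)// l2basisE eqxx mul1r big_seq big1 => [|j].
    by rewrite /= addr0 subrr normc0 ltW.
  by rewrite !inE l2basisE => /andP[/negPf ->] _; rewrite mul0r.
by rewrite -[LHS]conjcK -[RHS]conjcK -(E U)// -(E V)// -TU -TV.
Qed.

Definition adj T : bop := projT1 (cid (adjoint_exists T)).

Lemma adjP T : is_adjoint T (adj T).
Proof. by rewrite /adj; case: cid. Qed.

End bounded_operators.

Section nsq_seq.
Context (R : realType) (I : choiceType).

Lemma nsq_ge_seq (x : l2 R I) (s : seq I) : uniq s ->
  \sum_(i <- s) normc (x i) ^+ 2 <= nsq x.
Proof.
move=> us; apply: le_trans (nsq_ge x [fset i in s]%fset).
rewrite le_eqVlt; apply/orP; left; apply/eqP/perm_big/uniq_perm => //.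
by move=> i; rewrite !inE.
Qed.

Lemma sum_fset_le_seq (a : I -> R) (A : {fset I}) (s : seq I) :
  (forall i, 0 <= a i) -> uniq s -> {subset A <= s} ->
  \sum_(i <- A) a i <= \sum_(i <- s) a i.
Proof.
move=> a0 us As; rewrite [leRHS](_ : _ = \sum_(i <- [fset i in s]%fset) a i).
  by apply: subset_sum_le => //; apply/fsubsetP => i /As; rewrite inE.
by apply: perm_big; apply: uniq_perm => // i; rewrite !inE.
Qed.

End nsq_seq.

(* The operator x |-> (x_(u i))_i, where the coordinates with u i = None are
   set to 0; it is a contraction because u is injective where defined. *)
Section partial_reindexing.
Context (R : realType) (I : choiceType) (u : I -> option I).
Context (u_inj : forall i i' j, u i = Some j -> u i' = Some j -> i = i').

Let f (x : l2 R I) (i : I) : R[i] := if u i is Some j then x j else 0.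

Let f_le x (A : {fset I}) : \sum_(i <- A) normc (f x i) ^+ 2 <= nsq x.
Proof.
have -> : \sum_(i <- A) normc (f x i) ^+ 2 = \sum_(j <- pmap u A) normc (x j) ^+ 2.
  elim: (enum_fset A) => [|i s ih]; first by rewrite !big_nil.
  rewrite big_cons ih {1}/f /pmap -/pmap; case: (u i) => [j|]; first by rewrite /= big_cons.
  by rewrite normc0 expr0n add0r.
apply: nsq_ge_seq; elim: (enum_fset A) (fset_uniq A) => /= [//|i s ih] /andP[Ni /ih us].
case E : (u i) => [j|] //=; rewrite us andbT mem_pmap.
by apply: contra Ni => /mapP[k ks /esym/(u_inj E) ->].
Qed.

Let f_l2 x : f x \in @l2pred R I.
Proof. by apply/l2predP; exists (nsq x) => A; exact: f_le. Qed.

Let F x : l2 R I := L2 (f_l2 x).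

Let F_linear : linear F.
Proof.
move=> c x y; apply: l2_ext => i; rewrite l2ED l2EZ /= /f.
by case: (u i) => [j|]; rewrite ?mulr0 ?addr0.
Qed.

Let F_bounded : is_bounded F.
Proof.
apply/boundedP; exists 1; split=> // x; rewrite mul1r.
by apply/nsq_leP => A; exact: f_le.
Qed.

Definition reindex_op : bop R I := Bop F_linear F_bounded.

Lemma reindex_opE x i : reindex_op x i = if u i is Some j then x j else 0.
Proof. by []. Qed.

End partial_reindexing.

Section tensor.
Context (R : realType) (I J : choiceType).
Implicit Types (S : bop R I) (T : bop R J) (w : l2 R (I * J)%type).

(* l^2(I) (x) l^2(J) is identified with l^2(I * J), where the elementary tensor
   of x and y is (x_i y_j)_(i, j).  The tensor product of two operators is
   defined by letting each of them act on the slices of w : l^2(I * J); lemmas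
   tensE and tens_unique show that it is the only bounded operator such that
   (S (x) T) (x (x) y) = S x (x) T y. *)
Fact etens_subproof (x : l2 R I) (y : l2 R J) :
  (fun k : I * J => x k.1 * y k.2) \in @l2pred R (I * J)%type.
Proof.
apply/l2predP; exists (nsq x * nsq y) => A.
pose A1 := [fset k.1 | k in A]%fset; pose A2 := [fset k.2 | k in A]%fset.
apply: (@le_trans _ _ (\sum_(k <- [seq (i, j) | i <- A1, j <- A2])
    normc (x k.1 * y k.2) ^+ 2)).
  apply: sum_fset_le_seq => [k||[i j] ijA]; first exact: sqr_ge0.
    by rewrite allpairs_uniq// => -[? ?] [? ?] _ _ [-> ->].
  by apply/allpairsP; exists (i, j); split=> //=; apply/imfsetP; exists (i, j).
rewrite big_allpairs/=.
under eq_bigr do under eq_bigr do rewrite normcM exprMn.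
under eq_bigr do rewrite -mulr_sumr.
rewrite -mulr_suml ler_pM ?nsq_ge//; by apply: sumr_ge0 => i _; exact: sqr_ge0.
Qed.

Definition etens x y : l2 R (I * J)%type := L2 (etens_subproof x y).

Lemma etensE x y i j : etens x y (i, j) = x i * y j. Proof. by []. Qed.

Lemma etens_basis i j : etens (l2basis R i) (l2basis R j) = l2basis R (i, j).
Proof.
apply: l2_ext => -[k l]; rewrite etensE !l2basisE xpair_eqE.
by case: eqP => _; case: eqP => _; rewrite ?mulr0 ?mulr1.
Qed.

Fact slicel_subproof w j : (fun i => w (i, j)) \in @l2pred R I.
Proof.
apply/l2predP; exists (nsq w) => A.
rewrite -(big_map (fun i => (i, j)) xpredT (fun k => normc (w k) ^+ 2)).
by apply: nsq_ge_seq; rewrite map_inj_uniq ?fset_uniq// => a b [].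
Qed.
Definition slicel w j : l2 R I := L2 (slicel_subproof w j).

Fact slicer_subproof w i : (fun j => w (i, j)) \in @l2pred R J.
Proof.
apply/l2predP; exists (nsq w) => A.
rewrite -(big_map (fun j => (i, j)) xpredT (fun k => normc (w k) ^+ 2)).
by apply: nsq_ge_seq; rewrite map_inj_uniq ?fset_uniq// => a b [].
Qed.
Definition slicer w i : l2 R J := L2 (slicer_subproof w i).

Lemma slicel_sum w (B : {fset J}) : \sum_(j <- B) nsq (slicel w j) <= nsq w.
Proof.
rewrite -lee_fin -sumEFin.
rewrite (eq_bigr (fun j => l2sq (slicel w j))); last by move=> j _; rewrite nsqE.
rewrite -esum_sum => [|i j _ _]; last by rewrite lee_fin sqr_ge0.
under eq_esum do rewrite sumEFin.
apply/esum_leP => [i|A]; first by apply: sumr_ge0 => j _; exact: sqr_ge0.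
rewrite -(@big_allpairs _ _ _ _ _ A B (fun k => normc (w k) ^+ 2)).
apply: nsq_ge_seq; rewrite allpairs_uniq ?fset_uniq//.
by move=> [? ?] [? ?] _ _ [-> ->].
Qed.

Lemma slicer_sum w (A : {fset I}) : \sum_(i <- A) nsq (slicer w i) <= nsq w.
Proof.
rewrite -lee_fin -sumEFin.
rewrite (eq_bigr (fun i => l2sq (slicer w i))); last by move=> i _; rewrite nsqE.
rewrite -esum_sum => [|j i _ _]; last by rewrite lee_fin sqr_ge0.
under eq_esum do rewrite sumEFin.
apply/esum_leP => [j|B]; first by apply: sumr_ge0 => i _; exact: sqr_ge0.
rewrite exchange_big/=.
rewrite -(@big_allpairs _ _ _ _ _ A B (fun k => normc (w k) ^+ 2)).
apply: nsq_ge_seq; rewrite allpairs_uniq ?fset_uniq//.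
by move=> [? ?] [? ?] _ _ [-> ->].
Qed.

Section left_factor.
Context (S : bop R I).
Let f w (k : I * J) : R[i] := S (slicel w k.2) k.1.

Let f_le : exists M : R, 0 <= M /\ forall w (A : {fset I * J}),
  \sum_(k <- A) normc (f w k) ^+ 2 <= M * nsq w.
Proof.
have [M [M0 hM]] := bop_nsq S; exists M; split=> // w A.
pose A1 := [fset k.1 | k in A]%fset; pose A2 := [fset k.2 | k in A]%fset.
apply: (@le_trans _ _ (\sum_(k <- [seq (i, j) | i <- A1, j <- A2])
    normc (f w k) ^+ 2)).
  apply: sum_fset_le_seq => [k||[i j] ijA]; first exact: sqr_ge0.
    by rewrite allpairs_uniq// => -[? ?] [? ?] _ _ [-> ->].
  by apply/allpairsP; exists (i, j); split=> //=; apply/imfsetP; exists (i, j).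
rewrite big_allpairs exchange_big/= /f/=.
apply: (@le_trans _ _ (\sum_(j <- A2) M * nsq (slicel w j))).
  by apply: ler_sum => j _; apply: le_trans (hM _); exact: nsq_ge.
by rewrite -mulr_sumr ler_wpM2l// slicel_sum.
Qed.

Let f_l2 w : f w \in @l2pred R (I * J)%type.
Proof. by have [M [_ h]] := f_le; apply/l2predP; exists (M * nsq w). Qed.

Let F w : l2 R (I * J)%type := L2 (f_l2 w).

Let F_linear : linear F.
Proof.
move=> c v w; apply: l2_ext => -[i j]; rewrite l2ED l2EZ /= /f/=.
rewrite -l2EZ -l2ED -linearP; congr (bop_fun S _ _).
exact: l2_ext.
Qed.

Let F_bounded : is_bounded F.
Proof.
have [M [M0 h]] := f_le; apply/boundedP; exists M; split=> // w.
by apply/nsq_leP => A; exact: h.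
Qed.

Definition tensl : bop R (I * J)%type := Bop F_linear F_bounded.

Lemma tenslE w i j : tensl w (i, j) = S (slicel w j) i. Proof. by []. Qed.

End left_factor.

Section right_factor.
Context (T : bop R J).
Let f w (k : I * J) : R[i] := T (slicer w k.1) k.2.

Let f_le : exists M : R, 0 <= M /\ forall w (A : {fset I * J}),
  \sum_(k <- A) normc (f w k) ^+ 2 <= M * nsq w.
Proof.
have [M [M0 hM]] := bop_nsq T; exists M; split=> // w A.
pose A1 := [fset k.1 | k in A]%fset; pose A2 := [fset k.2 | k in A]%fset.
apply: (@le_trans _ _ (\sum_(k <- [seq (i, j) | i <- A1, j <- A2])
    normc (f w k) ^+ 2)).
  apply: sum_fset_le_seq => [k||[i j] ijA]; first exact: sqr_ge0.
    by rewrite allpairs_uniq// => -[? ?] [? ?] _ _ [-> ->].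
  by apply/allpairsP; exists (i, j); split=> //=; apply/imfsetP; exists (i, j).
rewrite big_allpairs /= /f/=.
apply: (@le_trans _ _ (\sum_(i <- A1) M * nsq (slicer w i))).
  by apply: ler_sum => i _; apply: le_trans (hM _); exact: nsq_ge.
by rewrite -mulr_sumr ler_wpM2l// slicer_sum.
Qed.

Let f_l2 w : f w \in @l2pred R (I * J)%type.
Proof. by have [M [_ h]] := f_le; apply/l2predP; exists (M * nsq w). Qed.

Let F w : l2 R (I * J)%type := L2 (f_l2 w).

Let F_linear : linear F.
Proof.
move=> c v w; apply: l2_ext => -[i j]; rewrite l2ED l2EZ /= /f/=.
rewrite -l2EZ -l2ED -linearP; congr (bop_fun T _ _).
exact: l2_ext.
Qed.

Let F_bounded : is_bounded F.
Proof.
have [M [M0 h]] := f_le; apply/boundedP; exists M; split=> // w.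
by apply/nsq_leP => A; exact: h.
Qed.

Definition tensr : bop R (I * J)%type := Bop F_linear F_bounded.

Lemma tensrE w i j : tensr w (i, j) = T (slicer w i) j. Proof. by []. Qed.

End right_factor.

Definition tens S T : bop R (I * J)%type := tensl S * tensr T.

Lemma tensE S T x y : tens S T (etens x y) = etens (S x) (T y).
Proof.
have r : tensr T (etens x y) = etens x (T y).
  apply: l2_ext => -[i j]; rewrite tensrE etensE.
  have -> : slicer (etens x y) i = x i *: y by exact: l2_ext.
  by rewrite linearZ.
rewrite /tens bopME r; apply: l2_ext => -[i j]; rewrite tenslE etensE.
have -> : slicel (etens x (T y)) j = T y j *: x.
  by apply: l2_ext => k; rewrite l2EZ mulrC.
by rewrite linearZ l2EZ mulrC.
Qed.

Lemma tens_unique S T (U : bop R (I * J)%type) :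
  (forall x y, U (etens x y) = etens (S x) (T y)) -> U = tens S T.
Proof.
move=> h; apply: bop_eq_basis => -[i j].
by rewrite -etens_basis h tensE.
Qed.

End tensor.

Notation "S \ox T" := (tens S T) (at level 40, left associativity) : ring_scope.

Section shifts.
Context (R : realType).

Let unishift_idx (n : nat) := Some n.+1.
Let unishift_inj i i' j : unishift_idx i = Some j -> unishift_idx i' = Some j -> i = i'.
Proof. by move=> [<-] [->]. Qed.
Definition unishift : bop R nat := reindex_op R unishift_inj.

Let proj0_idx (n : nat) := if n is 0%N then Some 0%N else None.
Let proj0_inj i i' j : proj0_idx i = Some j -> proj0_idx i' = Some j -> i = i'.
Proof. by case: i i' => [|?] []. Qed.
Definition proj0 : bop R nat := reindex_op R proj0_inj.

Let bishift_idx (n : int) := Some (n + 1).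
Let bishift_inj i i' j :
  bishift_idx i = Some j -> bishift_idx i' = Some j -> i = i'.
Proof. by move=> [<-] [/addIr]. Qed.
Definition bishift : bop R int := reindex_op R bishift_inj.

Let bishiftV_idx (n : int) := Some (n - 1).
Let bishiftV_inj i i' j :
  bishiftV_idx i = Some j -> bishiftV_idx i' = Some j -> i = i'.
Proof. by move=> [<-] [/addIr]. Qed.
Definition bishiftV : bop R int := reindex_op R bishiftV_inj.

Lemma unishiftE x n : unishift x n = x n.+1. Proof. by []. Qed.

Lemma unishift_basis0 : unishift (l2basis R 0%N) = 0.
Proof. exact: l2_ext. Qed.

Lemma unishift_basisS n : unishift (l2basis R n.+1) = l2basis R n.
Proof. exact: l2_ext. Qed.

Lemma proj0E x : proj0 x = x 0%N *: l2basis R 0%N.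
Proof.
by apply: l2_ext => -[|n]; rewrite l2EZ l2basisE/= ?mulr1 ?mulr0.
Qed.

Lemma bishiftE x n : bishift x n = x (n + 1). Proof. by []. Qed.

Lemma bishift_basis n : bishift (l2basis R n) = l2basis R (n - 1).
Proof.
by apply: l2_ext => k; rewrite bishiftE !l2basisE -subr_eq opprK.
Qed.

Lemma bishiftK : bishiftV * bishift = 1.
Proof. by apply: bop_ext => x; apply: l2_ext => n /=; rewrite subrK. Qed.

Lemma bishiftVK : bishift * bishiftV = 1.
Proof. by apply: bop_ext => x; apply: l2_ext => n /=; rewrite addrK. Qed.

(* The integer powers of the unitary bishift, whose inverse is bishiftV. *)
Definition bishiftX (r : int) : bop R int :=
  match r with
  | Posz k => bishift ^+ k
  | Negz k => bishiftV ^+ k.+1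
  end.

End shifts.

Definition is_inverse_semigroup (X : Type) (mul : X -> X -> X) (inv : X -> X)
    (T : set X) : Prop :=
  [/\ forall a b, T a -> T b -> T (mul a b),
      forall a b c, T a -> T b -> T c -> mul a (mul b c) = mul (mul a b) c,
      forall a, T a -> T (inv a)
    & forall a, T a ->
        unique (fun b => [/\ T b, mul (mul a b) a = a & mul (mul b a) b = b])
               (inv a)].

Section semigroup.
Context (R : realType).
Implicit Types (r : int) (n m : nat * nat).

Local Notation S := (unishift R).
Local Notation "S^*" := (adj (unishift R)).
Local Notation p := (proj0 R).
Local Notation t := (bishiftX R).

Definition B1 r n m : bop R (nat * nat * int)%type :=
  (S^* ^+ n.1 * S ^+ m.1) \ox (S^* ^+ n.1 * S ^+ m.1) \ox t r.

Definition B2 r n m : bop R (nat * nat * int)%type :=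
  (S^* ^+ n.1 * S ^+ m.1) \ox (S^* ^+ n.2 * p * S ^+ m.2) \ox t r.

Definition B3 r n m : bop R (nat * nat * int)%type :=
  (S^* ^+ n.1 * p * S ^+ m.1) \ox (S^* ^+ n.2 * S ^+ m.2) \ox t r.

Definition B4 r n m : bop R (nat * nat * int)%type :=
  (S^* ^+ n.1 * p * S ^+ m.1) \ox (S^* ^+ n.2 * p * S ^+ m.2) \ox t r.

Definition admissible1 r n m : Prop :=
  [/\ r = m.1%:Z - n.1%:Z, n.1 = n.2 & m.1 = m.2].

Definition admissible2 r n m : Prop :=
  [/\ r = m.1%:Z - n.1%:Z, (n.2 <= n.1)%N & (m.2 <= m.1)%N].

Definition admissible3 r n m : Prop :=
  [/\ r = m.2%:Z - n.2%:Z, (n.1 <= n.2)%N & (m.1 <= m.2)%N].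

Definition semigroupT : set (bop R (nat * nat * int)%type) :=
  [set A | exists r n m,
     [\/ admissible1 r n m /\ A = B1 r n m,
         admissible2 r n m /\ A = B2 r n m,
         admissible3 r n m /\ A = B3 r n m
       | A = B4 r n m]] `|` [set 0].

End semigroup.

Arguments semigroupT R : clear implicits.

(* Main.v *)
Require Import Defs.
From mathcomp Require Import all_boot all_order all_algebra.
From mathcomp Require Import all_classical all_reals all_analysis.
From mathcomp Require Import complex zify.
Import GRing.Theory.
Set Implicit Arguments.
Unset Strict Implicit.
Unset Printing Implicit Defensive.
Local Open Scope ring_scope.

(** Every element of [T] permutes the standard basis partially: its matrix is
that of a partial injection of [nat * nat * int].  Partial injections form an
inverse monoid, in which the adjoint is the inverse partial injection, so only
the stability of [T] under products and adjoints depends on the admissibility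
conditions.  Stability under products is checked factorwise: [S^*n S^m] and
[S^*n p S^m] are the translations [i |-> i - n + m] of [{i >= n}] and of [{n}],
and the product of two of them is zero or a translation of the same kind. *)

Section partial_maps.
Context (R : realType).

(* [A] is then the transpose of the matrix of [u], hence the order of
   composition in [represents_mul]. *)
Definition represents (I : choiceType) (A : bop R I) (u : I -> option I) : Prop :=
  forall x i, A x i = if u i is Some j then x j else 0.

Definition partial_inverse {I : Type} (u v : I -> option I) : Prop :=
  forall i j, u i = Some j <-> v j = Some i.

Lemma represents_ext (I : choiceType) (A B : bop R I) u v :
  represents A u -> represents B v -> u =1 v -> A = B.
Proof.
by move=> Au Bv uv; apply: bop_ext => x; apply: l2_ext => i; rewrite Au Bv uv.
Qed.

Lemma represents_inj (I : choiceType) (A : bop R I) u v :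
  represents A u -> represents A v -> u =1 v.
Proof.
move=> Au Av i.
have E j : (u i == Some j) = (v i == Some j).
  have b w : represents A w -> A (l2basis R j) i = (w i == Some j)%:R.
    by move=> ->; case: (w i) => [k|] //; rewrite l2basisE.
  have := b _ Au; rewrite (b _ Av); do 2!case: eqP => // _.
    by move/eqP; rewrite oner_eq0.
  by move/eqP; rewrite eq_sym oner_eq0.
case ui: (u i) => [j|]; first by apply/esym/eqP; rewrite -E ui.
by case vi: (v i) => [j|] //; have := E j; rewrite ui vi eqxx.
Qed.

Lemma represents_zero (I : choiceType) :
  represents (0 : bop R I) (fun=> None).
Proof. by []. Qed.

Lemma represents_mul (I : choiceType) (A B : bop R I) u v :
  represents A u -> represents B v -> represents (A * B) (fun i => obind v (u i)).
Proof. by move=> Au Bv x i; rewrite bopME Au; case: (u i) => [j|] //=. Qed.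

Lemma represents_tens (I J : choiceType) (A : bop R I) (B : bop R J) u v :
  represents A u -> represents B v ->
  represents (A \ox B)
    (fun k => obind (fun i => omap (pair i) (v k.2)) (u k.1)).
Proof.
move=> Au Bv x [i j]; rewrite /tens bopME tenslE Au /=.
case: (u i) => [k|] //=; rewrite -[LHS]/(tensr I B x (k, j)) tensrE Bv.
by case: (v j).
Qed.

Lemma inner_basisl (I : choiceType) (y : l2 R I) i :
  inner (l2basis R i) y = ((y i)^*)%C.
Proof.
rewrite -[RHS]mulr1; have <- : inner (l2basis R i) (l2basis R i) = 1.
  by rewrite inner_basisr l2basisE eqxx.
rewrite -innerZr /inner; congr summability.sum; apply/funext => k.
by rewrite l2EZ !l2basisE; case: eqP => [->|_]; rewrite ?mulr1// !mul0r.
Qed.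

Lemma represents_adj (I : choiceType) (A : bop R I) u v :
  represents A u -> partial_inverse u v -> represents (adj A) v.
Proof.
move=> Au uv y i; apply: (can_inj (@conjcK _)).
rewrite -inner_basisl -adjP.
case vi: (v i) => [j|].
  rewrite -inner_basisl; congr inner; apply: l2_ext => k; rewrite Au l2basisE.
  have [->|kj] := eqVneq k j; first by rewrite (uv j i).2// l2basisE eqxx.
  case uk: (u k) => [l|] //; rewrite l2basisE; case: eqP => // li.
  by move: uk; rewrite li => /uv; rewrite vi => -[jk]; rewrite jk eqxx in kj.
rewrite (_ : A _ = 0) ?inner0l ?conjc0//; apply: l2_ext => k; rewrite Au l2E0.
case uk: (u k) => [l|] //; rewrite l2basisE; case: eqP => // li.
by move: uk; rewrite li => /uv; rewrite vi.
Qed.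

Lemma partial_inverse_unique {I : Type} (u v w : I -> option I) :
  partial_inverse u w ->
  (forall i j j', v i = Some j -> v j' = Some j -> i = j') ->
  (forall i, obind u (obind v (u i)) = u i) ->
  (forall i, obind v (obind u (v i)) = v i) -> v =1 w.
Proof.
move=> uw vinj uvu vuv.
have vu i j : v i = Some j -> u j = Some i.
  move=> vi; have := vuv i; rewrite vi /=; case: (u j) => [k|] //= vk.
  by rewrite (vinj _ _ _ vi vk).
move=> i; case vi: (v i) => [j|]; first by apply/esym/uw/vu.
case wi: (w i) => [j|] //; have /uw uj := wi.
by have := uvu j; rewrite uj /= vi.
Qed.

Lemma partial_inverse_inj {I : Type} (u v : I -> option I) :
  partial_inverse u v -> forall i j j', u i = Some j -> u j' = Some j -> i = j'.
Proof. by move=> uv i j j' /uv vj /uv; rewrite vj => -[]. Qed.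

Lemma partial_inverseK {I : Type} (u v : I -> option I) :
  partial_inverse u v -> forall i, obind u (obind v (u i)) = u i.
Proof.
by move=> uv i; case ui: (u i) => [j|] //=; have /uv -> := ui; rewrite /= ui.
Qed.

Lemma partial_inverse_sym {I : Type} (u v : I -> option I) :
  partial_inverse u v -> partial_inverse v u.
Proof. by move=> uv i j; split=> /uv. Qed.

Lemma adj_inverse_unique (I : choiceType) (A B : bop R I) (u u' v v' : I -> option I) :
  represents A u -> partial_inverse u u' ->
  represents B v -> partial_inverse v v' ->
  A * B * A = A -> B * A * B = B -> adj A = B.
Proof.
move=> Au uu' Bv vv' ABA BAB.
apply: (represents_ext (represents_adj Au uu') Bv) => i; apply/esym; move: i.
apply: (partial_inverse_unique uu' (partial_inverse_inj vv')) => i.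
  have := represents_mul Au (represents_mul Bv Au); rewrite mulrA ABA.
  by move=> /(represents_inj Au)/(_ i) Ei; rewrite [RHS]Ei; case: (u i).
have := represents_mul Bv (represents_mul Au Bv); rewrite mulrA BAB.
by move=> /(represents_inj Bv)/(_ i) Ei; rewrite [RHS]Ei; case: (v i).
Qed.

Lemma adj_inverse (I : choiceType) (A : bop R I) u v :
  represents A u -> partial_inverse u v ->
  A * adj A * A = A /\ adj A * A * adj A = adj A.
Proof.
move=> Au uv; have Av := represents_adj Au uv; rewrite -!mulrA; split.
  apply: represents_ext (represents_mul Au (represents_mul Av Au)) Au _ => i.
  by rewrite -[RHS](partial_inverseK uv); case: (u i).
apply: represents_ext (represents_mul Av (represents_mul Au Av)) Av _ => i.
by rewrite -[RHS](partial_inverseK (partial_inverse_sym uv)); case: (v i).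
Qed.

Lemma tens_mul (I J : choiceType) (A A' : bop R I) (B B' : bop R J) :
  (A \ox B) * (A' \ox B') = (A * A') \ox (B * B').
Proof. by apply: tens_unique => x y; rewrite [LHS]bopME !tensE. Qed.

Lemma tens0l (I J : choiceType) (B : bop R J) : (0 : bop R I) \ox B = 0.
Proof.
apply/esym/tens_unique => x y; apply: l2_ext => -[i j].
by rewrite etensE !bop0E !l2E0 mul0r.
Qed.

Lemma tens0r (I J : choiceType) (A : bop R I) : A \ox (0 : bop R J) = 0.
Proof.
apply/esym/tens_unique => x y; apply: l2_ext => -[i j].
by rewrite etensE !bop0E !l2E0 mulr0.
Qed.

End partial_maps.

Section factors.
Context (R : realType).
Local Notation S := (unishift R).

Definition translation (c : bool) (n m i : nat) : option nat :=
  if (if c then i == n else n <= i)%N then Some (i - n + m)%N else None.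

Definition factor (c : bool) (n m : nat) : bop R nat :=
  if c then adj S ^+ n * proj0 R * S ^+ m else adj S ^+ n * S ^+ m.

Lemma translation_inverse c n m :
  partial_inverse (translation c n m) (translation c m n).
Proof.
by move=> i j; rewrite /translation; case: c; split;
  (case: ifP => // h [<-]); (case: ifP => [_|]; first congr Some); lia.
Qed.

Lemma represents_shiftX m : represents (S ^+ m) (translation false 0 m).
Proof.
move=> x i; rewrite /translation /= subn0.
elim: m x i => [|m ih] x i; first by rewrite addn0.
by rewrite exprS bopME unishiftE ih addSnnS.
Qed.

Lemma represents_adj_shiftX n :
  represents (adj S ^+ n) (translation false n 0).
Proof.
have adjS : represents (adj S) (translation false 1 0).
  apply: represents_adj (translation_inverse false 0 1).
  exact: represents_shiftX 1.
elim: n => [|n ih] x i; first by rewrite /translation /= subn0 addn0.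
rewrite exprS bopME adjS /translation; case: i => [|i] //=.
by rewrite ih /translation subn1 !addn0.
Qed.

Lemma represents_factor c n m : represents (factor c n m) (translation c n m).
Proof.
rewrite /factor; case: c => x i; rewrite !bopME represents_adj_shiftX /translation.
  have [ni|ni] := leqP n i; last by rewrite (ltn_eqF ni).
  rewrite -[LHS]/(proj0 R ((S ^+ m) x) (i - n + 0)%N) addn0 proj0E l2EZ.
  rewrite l2basisE represents_shiftX /translation /=.
  by rewrite subn_eq0 (@eqn_leq i) ni andbT; case: leqP => ni';
     rewrite ?mulr1 ?mulr0// (_ : i - n = 0)%N//; lia.
case: leqP => // ni; rewrite represents_shiftX /translation /=.
by rewrite subn0 addn0.
Qed.

Definition factor_comp_nz (c c' : bool) (m n' : nat) : bool :=
  (c ==> (n' <= m)%N) && (c' ==> (m <= n')%N).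

Lemma factor_mul c c' n m n' m' :
  factor c n m * factor c' n' m' =
  if factor_comp_nz c c' m n'
  then factor (c || c') (n + (n' - m)) (m' + (m - n')) else 0.
Proof.
have E := represents_mul (represents_factor c n m) (represents_factor c' n' m').
case: ifP => h.
  apply: represents_ext E (represents_factor _ _ _) _ => i.
  move: h; rewrite /factor_comp_nz /translation.
  by case: c => /=; case: c' => /=; move=> h; repeat case: ifP => //=; intros;
    try (congr Some); lia.
apply: represents_ext E (@represents_zero _ _) _ => i.
move: h; rewrite /factor_comp_nz /translation.
by case: c => /=; case: c' => /=; move=> h; repeat case: ifP => //=; intros; lia.
Qed.

Lemma represents_bishiftX (r : int) :
  represents (bishiftX R r) (fun k => Some (k + r)).
Proof.
move=> x k; case: r => n /=.
  elim: n x k => [|n ih] x k; first by rewrite addr0.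
  by rewrite exprS bopME bishiftE ih; congr (x _); lia.
rewrite NegzE; elim: n x k => [|n ih] x k; first by [].
rewrite exprS bopME -[LHS]/((bishiftV R ^+ n.+1) x (k - 1)) ih.
by congr (x _); lia.
Qed.

Lemma bishiftX_mul (r s : int) :
  bishiftX R r * bishiftX R s = bishiftX R (r + s).
Proof.
apply: represents_ext (represents_mul (represents_bishiftX r)
  (represents_bishiftX s)) (represents_bishiftX _) _ => k /=.
by rewrite addrA.
Qed.

End factors.

Section elements.
Context (R : realType).

Definition elt (c1 c2 : bool) (r : int) (n m : nat * nat) :
    bop R (nat * nat * int)%type :=
  factor R c1 n.1 m.1 \ox factor R c2 n.2 m.2 \ox bishiftX R r.

Definition admissible (c1 c2 : bool) (r : int) (n m : nat * nat) : Prop :=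
  match c1, c2 with
  | false, false => admissible1 r n m
  | false, true => admissible2 r n m
  | true, false => admissible3 r n m
  | true, true => True
  end.

Lemma semigroupTP (A : bop R (nat * nat * int)%type) :
  semigroupT R A <->
  A = 0 \/ exists c1 c2 r n m, admissible c1 c2 r n m /\ A = elt c1 c2 r n m.
Proof.
split=> [[[r [n [m h]]]|->]|[->|[c1 [c2 [r [n [m [h ->]]]]]]]]; first 2 last.
- by right.
- left; exists r, n, m; case: c1 h; case: c2 => h.
  + by constructor 4.
  + by constructor 3.
  + by constructor 2.
  + constructor 1; split=> //; rewrite /elt /B1 /=.
    by case: h => _ <- <-.
- right; case: h => [[h ->]|[h ->]|[h ->]|->].
  + exists false, false, r, n, m; split=> //; rewrite /elt /B1 /=.
    by case: h => _ <- <-.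
  + by exists false, true, r, n, m.
  + by exists true, false, r, n, m.
  + by exists true, true, r, n, m.
- by left.
Qed.

Definition elt_map (c1 c2 : bool) (r : int) (n m : nat * nat)
    (k : nat * nat * int) : option (nat * nat * int) :=
  obind (fun ij => omap (pair ij) (Some (k.2 + r)))
    (obind (fun i => omap (pair i) (translation c2 n.2 m.2 k.1.2))
      (translation c1 n.1 m.1 k.1.1)).

Lemma represents_elt c1 c2 r n m :
  represents (elt c1 c2 r n m) (elt_map c1 c2 r n m).
Proof.
exact: (represents_tens (represents_tens (@represents_factor _ _ _ _)
  (@represents_factor _ _ _ _)) (@represents_bishiftX _ _)).
Qed.

Lemma elt_map_inverse c1 c2 r n m :
  partial_inverse (elt_map c1 c2 r n m) (elt_map c1 c2 (- r) m n).
Proof.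
have half c1' c2' r' n' m' i j : elt_map c1' c2' r' n' m' i = Some j ->
    elt_map c1' c2' (- r') m' n' j = Some i.
  case: i j => [[i1 i2] k] [[j1 j2] l]; rewrite /elt_map /=.
  case E1: (translation c1' _ _ _) => [j1'|] //=.
  case E2: (translation c2' _ _ _) => [j2'|] //= [<- <- <-].
  move/translation_inverse: E1 => ->; move/translation_inverse: E2 => -> /=.
  by rewrite addrK.
move=> i j; split=> [/half//|/half]; by rewrite opprK.
Qed.

Lemma adj_elt c1 c2 r n m : adj (elt c1 c2 r n m) = elt c1 c2 (- r) m n.
Proof.
exact: represents_ext (represents_adj (represents_elt _ _ _ _ _)
  (elt_map_inverse _ _ _ _ _)) (represents_elt _ _ _ _ _) _.
Qed.

Lemma semigroupT_mul (A B : bop R (nat * nat * int)%type) :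
  semigroupT R A -> semigroupT R B -> semigroupT R (A * B).
Proof.
move=> /semigroupTP[->|[c1 [c2 [r [n [m [h ->]]]]]]].
  by rewrite mul0r => _; apply/semigroupTP; left.
move=> /semigroupTP[->|[c1' [c2' [r' [n' [m' [h' ->]]]]]]].
  by rewrite mulr0; apply/semigroupTP; left.
rewrite /elt !tens_mul bishiftX_mul !factor_mul; apply/semigroupTP.
case: ifP => h1; last by left; rewrite !tens0l.
case: ifP => h2; last by left; rewrite tens0r tens0l.
right; exists (c1 || c1'), (c2 || c2'), (r + r').
exists (n.1 + (n'.1 - m.1), n.2 + (n'.2 - m.2))%N.
exists (m'.1 + (m.1 - n'.1), m'.2 + (m.2 - n'.2))%N.
split=> //; move: h h' h1 h2; rewrite /factor_comp_nz.
by case: c1; case: c2; case: c1'; case: c2' => //=;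
  rewrite /admissible1 /admissible2 /admissible3 /=;
  repeat (case=> ? ? ?); intros; split; lia.
Qed.

Lemma semigroupT_represents (A : bop R (nat * nat * int)%type) :
  semigroupT R A -> exists u v, represents A u /\ partial_inverse u v.
Proof.
move=> /semigroupTP[->|[c1 [c2 [r [n [m [_ ->]]]]]]].
  by exists (fun=> None), (fun=> None); split.
exists (elt_map c1 c2 r n m), (elt_map c1 c2 (- r) m n).
by split; [exact: represents_elt|exact: elt_map_inverse].
Qed.

Lemma semigroupT_adj (A : bop R (nat * nat * int)%type) :
  semigroupT R A -> semigroupT R (adj A).
Proof.
move=> /semigroupTP[->|[c1 [c2 [r [n [m [h ->]]]]]]]; apply/semigroupTP.
  left; apply: represents_ext (represents_adj (v := fun=> None)
    (@represents_zero R _) _) (@represents_zero R _) _ => //.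
right; exists c1, c2, (- r), m, n; rewrite adj_elt; split=> //.
by move: h; case: c1; case: c2 => //= -[? ? ?]; split; lia.
Qed.

End elements.

Theorem proposition3p2 (R : realType) :
  is_inverse_semigroup (fun a b => a * b) (fun a => adj a) (semigroupT R).
Proof.
split.
- exact: semigroupT_mul.
- by move=> a b c _ _ _; exact: mulrA.
- exact: semigroupT_adj.
- move=> a Ta; have [u [u' [au uu']]] := semigroupT_represents Ta; split.
    by have [? ?] := adj_inverse au uu'; split=> //; exact: semigroupT_adj.
  move=> b [/semigroupT_represents[v [v' [bv vv']]] aba bab].
  exact: adj_inverse_unique au uu' bv vv' aba bab.
Qed.
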